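(* Let $H\in\mathbb{C}^{M\times N}$, $M\ge N$, have full column rank with thin QL decomposition $H=QL$, let $y\in\mathbb{C}^M$, $\tilde y=Q^\dagger y$, let $\mathcal{X}\subset\mathbb{C}$ be a finite nonempty set (the constellation), let $1\le\nu\le N-1$, and let $W_p$ be the puncturing matrix of order $\nu$ of $L$. If $$x_{ML}=\operatorname*{argmin}_{x\in\mathcal{X}^N}\|\tilde y-Lx\|\quad\text{and}\quad x_{WLD}=\operatorname*{argmin}_{x\in\mathcal{X}^N}\|W_p(\tilde y-Lx)\|,$$ then $$\|\tilde y-Lx_{ML}\|\le\|\tilde y-Lx_{WLD}\|\le\kappa(W_p)\,\|\tilde y-Lx_{ML}\|,$$ $$\|W_p(\tilde y-Lx_{WLD})\|\le\sigma_{\max}(W_p)\,\|\tilde y-Lx_{ML}\|,$$ where $\sigma_{\max}(W_p)$ and $\sigma_{\min}(W_p)$ are the largest and smallest singular values of $W_p$ and $\kappa(W_p)=\sigma_{\max}(W_p)/\sigma_{\min}(W_p)$ is its condition number.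
   Context: $(\cdot)^\dagger$ is the conjugate transpose; $\|\cdot\|$ is the Euclidean norm; $\mathrm{diag}(A)$ denotes the diagonal matrix with the same diagonal entries as $A$. ''argmin'' denotes any minimizer. Thin QL decomposition: $H=QL$ with $Q\in\mathbb{C}^{M\times N}$, $Q^\dagger Q=I_N$, and $L\in\mathbb{C}^{N\times N}$ lower triangular with real positive diagonal entries. Puncturing matrix of order $\nu$: partition $L=\begin{bmatrix}P&0\\R&S\end{bmatrix}$ with $P$ of size $\nu\times\nu$ and $S$ of size $(N-\nu)\times(N-\nu)$, put $\Omega=\mathrm{diag}(S^{-1}S^{-\dagger})^{-1/2}$, and $W_p=\begin{bmatrix}I_\nu&0\\0&\Omega S^{-1}\end{bmatrix}$. *)

(* Defs.v *)
From HB Require Import structures.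
From mathcomp Require Import all_boot all_order all_algebra finmap.
From mathcomp Require Import sesquilinear spectral.
From mathcomp Require Import all_classical all_reals.
From mathcomp Require Import complex.

Set Implicit Arguments.
Unset Strict Implicit.
Unset Printing Implicit Defensive.

Import Order.TTheory GRing.Theory Num.Theory.

#[global] Open Scope ring_scope.
#[global] Open Scope sesquilinear_scope.

Definition enorm (R : realType) (n : nat) (v : 'cV[R[i]]_n) : R :=
  Num.sqrt (\sum_i ComplexField.Normc.normc (v i 0) ^+ 2).

(* In the order of R[i], 0 < z means that z is real and positive; [is_trig_mx]
   is lower triangularity. *)
Definition thin_QL (R : realType) (M N : nat)
    (H Q : 'M[R[i]]_(M, N)) (L : 'M[R[i]]_N) : Prop :=
  [/\ H = Q *m L,
      Q ^t* *m Q = 1%:M,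
      is_trig_mx L
    & forall i, 0 < L i i].

(* diag(A)^{-1/2}, for A with positive diagonal entries. *)
Definition diag_invsqrt (R : realType) (n : nat) (A : 'M[R[i]]_n) : 'M[R[i]]_n :=
  diag_mx (\row_i (sqrtC (A i i))^-1).

(* The order nu and the size N of L are related by N = nu + k, so that L comes
   partitioned, with S = drsubmx L of size k = N - nu. *)
Definition puncturing_mx (R : realType) (nu k : nat)
    (L : 'M[R[i]]_(nu + k)) : 'M[R[i]]_(nu + k) :=
  let S := drsubmx L in
  let Omega := diag_invsqrt (invmx S *m (invmx S) ^t*) in
  block_mx 1%:M 0 0 (Omega *m invmx S).

Definition singular_value (R : realType) (m n : nat) (A : 'M[R[i]]_(m, n))
    (s : R) : Prop :=
  0 <= s /\ eigenvalue (A ^t* *m A) (s ^+ 2)%:C%C.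

(* For n > 0 the set of singular values is finite and nonempty, so the
   supremum and the infimum are its largest and smallest elements: see
   [sigma_maxP] and [sigma_minP]. *)
Definition sigma_max (R : realType) (m n : nat) (A : 'M[R[i]]_(m, n)) : R :=
  sup [set s | singular_value A s]%classic.

Definition sigma_min (R : realType) (m n : nat) (A : 'M[R[i]]_(m, n)) : R :=
  inf [set s | singular_value A s]%classic.

Definition cond_number (R : realType) (m n : nat) (A : 'M[R[i]]_(m, n)) : R :=
  sigma_max A / sigma_min A.

Definition in_constellation (R : realType) (n : nat) (X : {fset R[i]})
    (x : 'cV[R[i]]_n) : Prop :=
  forall i, x i 0 \in X.

Definition is_argmin (R : realType) (T : Type) (D : T -> Prop) (f : T -> R)
    (x0 : T) : Prop :=
  D x0 /\ forall x, D x -> f x0 <= f x.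

Section SingularValues.
Context (R : realType) (m n : nat) (A : 'M[R[i]]_(m, n)).

Lemma singular_value_exists : (0 < n)%N -> exists s, singular_value A s.
Proof.
move=> n0; have [a ea] := eigenvalue_closed (A ^t* *m A) n0.
have a_ge0 : 0 <= a.
  have /eigenvalueP [v vG v0] := ea.
  have E : dotmx (v *m A ^t*) (v *m A ^t*) = a * dotmx v v.
    rewrite !dotmxE trmx_mul map_mxM trmxCK.
    by rewrite -mulmxA [A^t* *m _]mulmxA mulmxA vG -scalemxAl mxE.
  have vv : 0 < dotmx v v by exact: dotmx_is_dotmx.
  rewrite -(pmulr_lge0 a vv) -E; have [->|/dotmx_is_dotmx/ltW//] := eqVneq (v *m A ^t*) 0.
  by rewrite dotmxE mul0mx mxE.
move: a_ge0; rewrite lecE /= => /andP[/eqP aI aR].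
have aE : a = (complex.Re a)%:C%C by move: aI; case: (a) => x y /= ->.
exists (Num.sqrt (complex.Re a)); split; first exact: sqrtr_ge0.
by rewrite (sqr_sqrtr aR) -aE.
Qed.

Lemma singular_value_finite :
  exists l : seq R, forall s, singular_value A s -> s \in l.
Proof.
have [r rE] := closed_field_poly_normal (char_poly (A ^t* *m A)).
exists [seq Num.sqrt (complex.Re a) | a <- r] => s [s0].
rewrite eigenvalue_root_char rE rootZ ?lead_coef_eq0 ?monic_neq0 ?char_poly_monic//.
rewrite root_prod_XsubC => sr; apply/mapP; exists (s ^+ 2)%:C%C => //=.
by rewrite sqrtr_sqr ger0_norm.
Qed.

Lemma sigma_maxP : (0 < n)%N -> singular_value A (sigma_max A) /\
  forall s, singular_value A s -> s <= sigma_max A.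
Proof.
move=> /singular_value_exists[s0 Ps0].
have [l lP] := singular_value_finite.
have [x Px xmax] : exists2 x, singular_value A x &
    forall s, s \in l -> singular_value A s -> s <= x.
  elim: l {lP} => [|t l [x Px xmax]]; first by exists s0.
  have [[Pt xt]|nt] := pselect (singular_value A t /\ x <= t).
    exists t => // s; rewrite inE => /orP[/eqP->//|sl Ps].
    by rewrite (le_trans _ xt)// xmax.
  exists x => // s; rewrite inE => /orP[/eqP->|]; last exact: xmax.
  by move=> Pt; rewrite leNgt; apply/negP => /ltW xt; apply: nt.
have xub : forall s, singular_value A s -> s <= x.
  by move=> s Ps; apply: xmax => //; exact: lP.
suff -> : sigma_max A = x by [].
apply/eqP; rewrite eq_le; apply/andP; split.
  by apply: ge_sup xub; exists x.
by apply: ub_le_sup Px; exists x.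
Qed.

Lemma sigma_minP : (0 < n)%N -> singular_value A (sigma_min A) /\
  forall s, singular_value A s -> sigma_min A <= s.
Proof.
move=> /singular_value_exists[s0 Ps0].
have [l lP] := singular_value_finite.
have [x Px xmin] : exists2 x, singular_value A x &
    forall s, s \in l -> singular_value A s -> x <= s.
  elim: l {lP} => [|t l [x Px xmin]]; first by exists s0.
  have [[Pt tx]|nt] := pselect (singular_value A t /\ t <= x).
    exists t => // s; rewrite inE => /orP[/eqP->//|sl Ps].
    by rewrite (le_trans tx)// xmin.
  exists x => // s; rewrite inE => /orP[/eqP->|]; last exact: xmin.
  by move=> Pt; rewrite leNgt; apply/negP => /ltW tx; apply: nt.
have xlb : forall s, singular_value A s -> x <= s.
  by move=> s Ps; apply: xmin => //; exact: lP.
suff -> : sigma_min A = x by [].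
apply/eqP; rewrite eq_le; apply/andP; split.
  by apply: ge_inf Px; exists x.
by apply: lb_le_inf xlb; exists x.
Qed.

End SingularValues.

(* Main.v *)
(** Unitarily diagonalising [Wp ^t* *m Wp] gives
    [sigma_min Wp * |v| <= |Wp v| <= sigma_max Wp * |v|].  As the diagonal of
    [L] is positive, [Wp] is invertible and [sigma_min Wp > 0], so the bounds
    follow from
    [sigma_min Wp * |e_WLD| <= |Wp e_WLD| <= |Wp e_ML| <= sigma_max Wp * |e_ML|]
    for the residuals [e = yt - L *m x]. *)
Require Import Defs.
From mathcomp Require Import all_boot all_order all_algebra finmap.
From mathcomp Require Import sesquilinear spectral.
From mathcomp Require Import all_classical all_reals.
From mathcomp Require Import complex.

Set Implicit Arguments.
Unset Strict Implicit.
Unset Printing Implicit Defensive.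

Import Order.TTheory GRing.Theory Num.Theory.

Section SingularValueBounds.
Context (R : realType).
Implicit Types m n : nat.

Lemma enorm_ge0 n (v : 'cV[R[i]]_n) : 0 <= enorm v.
Proof. exact: sqrtr_ge0. Qed.

Lemma sqr_enorm n (v : 'cV[R[i]]_n) :
  enorm v ^+ 2 = \sum_i ComplexField.Normc.normc (v i 0) ^+ 2.
Proof. by rewrite sqr_sqrtr// sumr_ge0// => i _; exact: sqr_ge0. Qed.

Lemma sqr_normc_conjC (z : R[i]) :
  (ComplexField.Normc.normc z ^+ 2)%:C%C = z^* * z.
Proof. by rewrite rmorphXn mulrC -normCK. Qed.

Lemma enorm_gram n (v : 'cV[R[i]]_n) :
  (enorm v ^+ 2)%:C%C = (v ^t* *m v) 0 0.
Proof.
rewrite sqr_enorm rmorph_sum !mxE; apply: eq_bigr => i _.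
by rewrite !mxE -sqr_normc_conjC.
Qed.

Lemma enorm_unitary n (P : 'M[R[i]]_n) (v : 'cV[R[i]]_n) :
  P \is unitarymx -> enorm (P *m v) = enorm v.
Proof.
move=> P_unitary; apply/eqP; rewrite -(eqrXn2 (n := 2)) ?enorm_ge0//.
apply/eqP/(@complexI R); rewrite !enorm_gram.
by rewrite trmx_mul map_mxM mulmxA mulmxKtV.
Qed.

(** A row eigenvector [v] satisfies [|v A ^t*|^2 = a |v|^2] with [|v|^2 > 0]. In the order of [R[i]]
    the conclusion also says that [a] is real, which makes it the square of a singular value. *)
Lemma eigenvalue_gram_ge0 m n (A : 'M[R[i]]_(m, n)) (a : R[i]) :
  eigenvalue (A ^t* *m A) a -> 0 <= a.
Proof.
move=> /eigenvalueP[v vG v_neq0].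
have v_gt0 : 0 < dotmx v v by exact: dotmx_is_dotmx.
have dotE : dotmx (v *m A ^t*) (v *m A ^t*) = a * dotmx v v.
  by rewrite !dotmxE trmx_mul map_mxM trmxCK -mulmxA [A^t* *m _]mulmxA
             mulmxA vG -scalemxAl mxE.
rewrite -(pmulr_lge0 a v_gt0) -dotE.
have [->|/dotmx_is_dotmx/ltW//] := eqVneq (v *m A ^t*) 0.
by rewrite dotmxE mul0mx mxE.
Qed.

(** Spectral theorem for the normal matrix [A ^t* *m A]: in the unitary coordinates [P *m v] the
    form [|A v|^2] is diagonal, weighted by squared singular values. Both norm bounds are then
    compared weight by weight. *)
Lemma singular_value_basis m n (A : 'M[R[i]]_(m, n)) :
  exists2 P : 'M[R[i]]_n, P \is unitarymx &
  exists2 s : 'I_n -> R, forall i, singular_value A (s i) &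
  forall v, enorm (A *m v) ^+ 2 =
    \sum_i s i ^+ 2 * ComplexField.Normc.normc ((P *m v) i 0) ^+ 2.
Proof.
set G := A ^t* *m A.
have G_normal : G \is normalmx.
  by apply/normalmxP; rewrite /G trmx_mul map_mxM trmxCK.
have P_unitary := spectral_unitarymx G.
have /orthomx_spectralP := G_normal.
set P := spectralmx G in P_unitary *; set d := spectral_diag G => GE.
(* Since [G = invmx P *m diag_mx d *m P], each row of [P] is a left eigenvector of [G]; it is
   nonzero because it has norm 1. *)
have d_eigen i : eigenvalue G (d 0 i).
  apply/eigenvalueP; exists (row i P).
    rewrite -row_mul {1}GE !mulmxA mulmxV ?unitarymx_unit// mul1mx.
    by rewrite row_mul row_diag_mx -scalemxAl -rowE.
  apply/eqP => row_eq0; have /row_unitarymxP/(_ i i) := P_unitary.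
  by rewrite row_eq0 dotmxE mul0mx mxE eqxx => /eqP; rewrite eq_sym oner_eq0.
pose s i := Num.sqrt (complex.Re (d 0 i)).
have dE i : d 0 i = (s i ^+ 2)%:C%C.
  have := eigenvalue_gram_ge0 (d_eigen i); rewrite lecE /= /s.
  case: (d 0 i) => x y /= /andP[/eqP-> x_ge0].
  by rewrite sqr_sqrtr.
exists P => //; exists s => [i|v].
  by split; [exact: sqrtr_ge0 | rewrite -dE].
(* Embedded in [R[i]], the left side is [v ^t* *m G *m v], which regroups as the diagonal form of
   [d] at [P *m v] because [invmx P = P ^t*]. *)
apply: (@complexI R); rewrite enorm_gram trmx_mul map_mxM.
rewrite -mulmxA [A ^t* *m _]mulmxA -/G GE invmx_unitary// !mulmxA.
rewrite -map_mxM -trmx_mul -!mulmxA mxE rmorph_sum.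
apply: eq_bigr => i _.
rewrite mul_diag_mx /= rmorphM/= -dE sqr_normc_conjC.
by rewrite !mxE mulrCA; congr (_ * (_ * _)).
Qed.

Lemma enorm_mulmx_le m n (A : 'M[R[i]]_(m, n)) (v : 'cV[R[i]]_n) :
  (0 < n)%N -> enorm (A *m v) <= sigma_max A * enorm v.
Proof.
move=> n_gt0; have [[smax_ge0 _] smaxP] := sigma_maxP A n_gt0.
have [P P_unitary [s sP normE]] := singular_value_basis A.
rewrite -(ler_pXn2r (n := 2)) ?nnegrE ?mulr_ge0 ?enorm_ge0//.
rewrite normE exprMn -(enorm_unitary v P_unitary) sqr_enorm mulr_sumr.
apply: ler_sum => i _; apply: ler_wpM2r; first exact: sqr_ge0.
have [si_ge0 _] := sP i.
by apply: lerXn2r; [exact: si_ge0 | exact: smax_ge0 | exact: smaxP (sP i)].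
Qed.

Lemma enorm_mulmx_ge m n (A : 'M[R[i]]_(m, n)) (v : 'cV[R[i]]_n) :
  (0 < n)%N -> sigma_min A * enorm v <= enorm (A *m v).
Proof.
move=> n_gt0; have [[smin_ge0 _] sminP] := sigma_minP A n_gt0.
have [P P_unitary [s sP normE]] := singular_value_basis A.
rewrite -(ler_pXn2r (n := 2)) ?nnegrE ?mulr_ge0 ?enorm_ge0//.
rewrite normE exprMn -(enorm_unitary v P_unitary) sqr_enorm mulr_sumr.
apply: ler_sum => i _; apply: ler_wpM2r; first exact: sqr_ge0.
have [si_ge0 _] := sP i.
by apply: lerXn2r; [exact: smin_ge0 | exact: si_ge0 | exact: sminP (sP i)].
Qed.

Lemma trmxC_unit n (A : 'M[R[i]]_n) : (A ^t* \in unitmx) = (A \in unitmx).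
Proof. by rewrite map_unitmx unitmx_tr. Qed.

(** The infimum is attained, so if it were 0 then 0 would be an eigenvalue of the invertible matrix
    [A ^t* *m A]. *)
Lemma sigma_min_gt0 n (A : 'M[R[i]]_n) :
  (0 < n)%N -> A \in unitmx -> 0 < sigma_min A.
Proof.
move=> n_gt0 A_unit; have [[smin_ge0 smin_eigen] _] := sigma_minP A n_gt0.
rewrite lt_def smin_ge0 andbT; apply/eqP => smin0.
move: smin_eigen; rewrite smin0 expr0n => /eigenvalueP[v].
rewrite scale0r => vG; apply/negP; rewrite negbK.
have G_unit : A ^t* *m A \in unitmx by rewrite unitmx_mul trmxC_unit A_unit.
by rewrite -(mulmxK G_unit v) vG mul0mx.
Qed.

(** The diagonal entries of [A *m A ^t*] are the squared norms of the rows of [A], so none of them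
    vanishes. *)
Lemma diag_invsqrt_gram_unit n (A : 'M[R[i]]_n) :
  A \in unitmx -> diag_invsqrt (A *m A ^t*) \in unitmx.
Proof.
move=> A_unit; rewrite unitmxE unitfE det_diag.
apply/prodf_neq0 => i _; rewrite !mxE invr_neq0// sqrtC_eq0.
have rowA_neq0 : row i A != 0.
  (* A zero row of [A] would give a zero row of [A *m invmx A = 1]. *)
  apply/eqP => row_eq0; have := congr1 (row i) (mulmxV A_unit).
  rewrite row_mul row_eq0 mul0mx => /rowP/(_ i)/eqP.
  by rewrite !mxE eqxx eq_sym oner_eq0.
have := dotmx_is_dotmx rowA_neq0.
rewrite lt_def dotmxE mxE => /andP[+ _].
by under eq_bigr do rewrite !mxE; under [X in _ -> X != 0]eq_bigr do rewrite !mxE.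
Qed.

(** The block is again lower triangular, and its diagonal is a part of that of [L], so its
    determinant is a product of nonzero entries. *)
Lemma drsubmx_trig_unit p q (L : 'M[R[i]]_(p + q)) :
  is_trig_mx L -> (forall i, L i i != 0) -> drsubmx L \in unitmx.
Proof.
move=> /is_trig_mxP L_trig L_diag; rewrite unitmxE unitfE det_trig; last first.
  by apply/is_trig_mxP => i j ltij; rewrite !mxE L_trig//= ltn_add2l.
by apply/prodf_neq0 => i _; rewrite !mxE.
Qed.

Lemma puncturing_mx_unit nu k (L : 'M[R[i]]_(nu + k)) :
  drsubmx L \in unitmx -> puncturing_mx L \in unitmx.
Proof.
move=> S_unit; rewrite unitmxE det_ublock det1 mul1r -unitmxE unitmx_mul.
by rewrite unitmx_inv S_unit diag_invsqrt_gram_unit ?unitmx_inv.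
Qed.

End SingularValueBounds.

Theorem lemma2 (R : realType) (M nu k : nat)
    (nu_gt0 : (0 < nu)%N) (k_gt0 : (0 < k)%N) (leNM : (nu + k <= M)%N)
    (H Q : 'M[R[i]]_(M, nu + k)) (L : 'M[R[i]]_(nu + k))
    (H_rank : \rank H = (nu + k)%N) (H_QL : thin_QL H Q L)
    (y : 'cV[R[i]]_M) (yt : 'cV[R[i]]_(nu + k)) (yt_def : yt = Q ^t* *m y)
    (X : {fset R[i]}) (X_neq0 : X != fset0)
    (Wp : 'M[R[i]]_(nu + k)) (Wp_def : Wp = puncturing_mx L)
    (x_ML x_WLD : 'cV[R[i]]_(nu + k))
    (x_ML_argmin :
       is_argmin (in_constellation X) (fun x => enorm (yt - L *m x)) x_ML)
    (x_WLD_argmin :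
       is_argmin (in_constellation X)
                 (fun x => enorm (Wp *m (yt - L *m x))) x_WLD) :
  [/\ enorm (yt - L *m x_ML) <= enorm (yt - L *m x_WLD),
      enorm (yt - L *m x_WLD) <= cond_number Wp * enorm (yt - L *m x_ML)
    & enorm (Wp *m (yt - L *m x_WLD)) <= sigma_max Wp * enorm (yt - L *m x_ML)].
Proof.
have N_gt0 : (0 < nu + k)%N by rewrite addn_gt0 nu_gt0.
case: H_QL => _ _ L_trig L_diag.
have Wp_unit : Wp \in unitmx.
  rewrite Wp_def puncturing_mx_unit// drsubmx_trig_unit// => i.
  by rewrite gt_eqF.
case: x_ML_argmin x_WLD_argmin => ML_in ML_min [WLD_in WLD_min].
have W_le : enorm (Wp *m (yt - L *m x_WLD)) <=
    sigma_max Wp * enorm (yt - L *m x_ML).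
  by rewrite (le_trans (WLD_min _ ML_in))// enorm_mulmx_le.
split=> //; first exact: ML_min.
(* Clearing the positive denominator [sigma_min Wp] leaves a bound that passes through
   [|Wp e_WLD|]. *)
rewrite /cond_number mulrAC ler_pdivlMr ?sigma_min_gt0// mulrC.
by rewrite (le_trans _ W_le)// enorm_mulmx_ge.
Qed.
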